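(* Let $\Phi:\mathbb{M}_n\to\mathbb{M}_l$ and $\Psi:\mathbb{M}_m\to\mathbb{M}_l$ be positive linear maps. Let $\varphi_0,\varphi_1$ be arbitrary non-negative functions on $[0,\infty)$ and $0\le\alpha\le1$. Define $\varphi_\alpha(x):=\varphi_0(x)^{1-\alpha}\varphi_1(x)^\alpha$ on $[0,\infty)$ (with convention $0^0:=1$). Then for every $A\in\mathbb{M}_n^+$ and $B\in\mathbb{M}_m^+$, $$\bigl\|\Phi(\varphi_\alpha(A))^{1/2}\Psi(\varphi_\alpha(B))\Phi(\varphi_\alpha(A))^{1/2}\bigr\|_\infty\le\bigl\|\Phi(\varphi_0(A))^{1/2}\Psi(\varphi_0(B))\Phi(\varphi_0(A))^{1/2}\bigr\|_\infty^{1-\alpha}\bigl\|\Phi(\varphi_1(A))^{1/2}\Psi(\varphi_1(B))\Phi(\varphi_1(A))^{1/2}\bigr\|_\infty^\alpha.$$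
   Context: $\mathbb{M}_n$ is the algebra of $n\times n$ complex matrices and $\mathbb{M}_n^+$ the set of positive semidefinite matrices in $\mathbb{M}_n$; $\|\cdot\|_\infty$ is the operator norm. A linear map $\Phi:\mathbb{M}_n\to\mathbb{M}_l$ is positive if $\Phi(A)\in\mathbb{M}_l^+$ for all $A\in\mathbb{M}_n^+$. For a function $\varphi$ on $[0,\infty)$ and $A\in\mathbb{M}_n^+$, $\varphi(A)$ is defined by functional calculus (applying $\varphi$ to the eigenvalues). The convention $0^0:=1$ is also used for the powers of norms. *)

(* Defs.v *)
From HB Require Import structures.
From mathcomp Require Import all_boot all_order all_algebra.
From mathcomp Require Import complex.
From mathcomp Require Import classical_sets reals exp.

Set Implicit Arguments.
Unset Strict Implicit.
Unset Printing Implicit Defensive.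

Import Order.TTheory GRing.Theory Num.Theory.

Local Open Scope ring_scope.
Local Open Scope complex_scope.
Local Open Scope classical_set_scope.
Local Open Scope sesquilinear_scope.

(* In the order of R[i], 0 <= z means that z is real and nonnegative. *)
Definition psdmx (R : realType) (n : nat) (A : 'M[R[i]]_n) : Prop :=
  A \is hermsymmx /\ forall x : 'cV[R[i]]_n, 0 <= (x^t* *m A *m x) 0 0.

Definition positive_map (R : realType) (n l : nat)
    (Phi : 'M[R[i]]_n -> 'M[R[i]]_l) : Prop :=
  forall A : 'M[R[i]]_n, psdmx A -> psdmx (Phi A).

(* Functional calculus through a unitary diagonalization of A. It is meant for
   Hermitian A, whose spectrum is real, and only uses the values of f at the
   eigenvalues of A; mxfun_diag below shows that the result does not depend on
   the diagonalization chosen by spectralmx. *)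
Definition mxfun (R : realType) (n : nat) (f : R -> R) (A : 'M[R[i]]_n) :
    'M[R[i]]_n :=
  invmx (spectralmx A)
    *m diag_mx (map_mx (fun z => (f (complex.Re z))%:C) (spectral_diag A))
    *m spectralmx A.

Definition mxsqrt (R : realType) (n : nat) (A : 'M[R[i]]_n) : 'M[R[i]]_n :=
  mxfun Num.sqrt A.

Definition l2norm (R : realType) (n : nat) (x : 'cV[R[i]]_n) : R :=
  Num.sqrt (\sum_(i < n) Normc.normc (x i 0) ^+ 2).

Definition opnorm (R : realType) (m n : nat) (A : 'M[R[i]]_(m, n)) : R :=
  sup [set l2norm (A *m x) | x in [set x : 'cV[R[i]]_n | l2norm x <= 1]].

(* powR satisfies 0 `^ 0 = 1 and 0 `^ a = 0 for a != 0. *)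
Definition geom_interp (R : realType) (a : R) (f g : R -> R) : R -> R :=
  fun x => powR (f x) (1 - a) * powR (g x) a.

Lemma mxfun_diag (R : realType) (n : nat) (f : R -> R) (P : 'M[R[i]]_n)
    (d : 'rV[R]_n) : P \is unitarymx ->
  mxfun f (invmx P *m diag_mx (map_mx (real_complex R) d) *m P) =
  invmx P *m diag_mx (map_mx (fun t => (f t)%:C) d) *m P.
Proof.
move=> PU; set D := map_mx (real_complex R) d; set A := _ *m _ *m P.
have Pu := unitarymx_unit PU.
have An : A \is normalmx.
  by apply/orthomx_spectral_subproof; exists (P, D).
have /orthomx_spectralP := An.
rewrite /mxfun; have := spectral_unit A.
move: (spectralmx A) (spectral_diag A) => Q e Qu AQ.
pose U := P *m invmx Q.
have UE : U *m diag_mx e = diag_mx D *m U.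
  have := congr1 (fun X => P *m X *m invmx Q) AQ.
  by rewrite /A /U !mulmxA mulmxV // mul1mx mulmxK // => ->.
suff UfE : U *m diag_mx (map_mx (fun z => (f (complex.Re z))%:C) e) =
    diag_mx (map_mx (fun t => (f t)%:C) d) *m U.
  have := congr1 (fun X => invmx P *m X *m Q) UfE.
  by rewrite /U !mulmxA mulVmx // mul1mx => ->; rewrite mulmxKV.
apply/matrixP => i j; move/matrixP/(_ i j): UE; move: U => U.
rewrite !mul_mx_diag !mul_diag_mx !mxE => UE.
have [->|U0] := eqVneq (U i j) 0; first by rewrite mul0r mulr0.
by move: UE; rewrite mulrC => /(mulIf U0) ->; rewrite /= mulrC.
Qed.

(* Main.v *)
(** Decomposing A and B spectrally turns Phi (p(A)) and Psi (q(B)) into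
    nonnegative combinations X_p, Y_q of fixed positive semidefinite matrices.
    If p^2 <= p0 p1 pointwise, the Cauchy-Schwarz inequality gives
    |u* X_p v|^2 <= (u* X_p0 u) (v* X_p1 v), and likewise for Y.
    With G(p,q) = |X_p^(1/2) Y_q X_p^(1/2)|, one has
    X_p Y_q X_p <= G(p,q) X_p and Y_q X_p Y_q <= G(p,q) Y_q.  Let w be an
    eigenvector of Y_q X_p for the eigenvalue a = G(p,q), and let h = X_p w,
    N = h* Y_q0 h.  Then
      a N = (Y_q0 h)* X_p (Y_q h),
      (Y_q0 h)* X_p0 (Y_q0 h) <= G(p0,q0) N,
      (Y_q h)* X_p1 (Y_q h) <= G(p1,q1) N,
    whence G(p,q)^2 <= G(p0,q0) G(p1,q1).  For p, q taken from the
    interpolating family this is midpoint log-convexity in the exponent on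
    the whole of [0, 1]; the same inequality with p0 = p1 and q0 = q1 a common
    upper bound shows boundedness, and together these replace an appeal to
    the three lines theorem. *)
Require Import Defs.
From HB Require Import structures.
From mathcomp Require Import all_boot all_order all_algebra.
From mathcomp Require Import complex.
From mathcomp Require Import boolp classical_sets reals exp.
From mathcomp Require Import ring lra.

Set Implicit Arguments.
Unset Strict Implicit.
Unset Printing Implicit Defensive.

Import Order.TTheory GRing.Theory Num.Theory.

Local Open Scope ring_scope.
Local Open Scope complex_scope.
Local Open Scope sesquilinear_scope.

(** * Cauchy-Schwarz for finite sums of scalars *)

Lemma le_sqr_normD (C : numClosedFieldType) (z z' a b a' b' : C) :
  0 <= a -> 0 <= b -> 0 <= a' -> 0 <= b' ->
  `|z| ^+ 2 <= a * b -> `|z'| ^+ 2 <= a' * b' ->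
  `|z + z'| ^+ 2 <= (a + a') * (b + b').
Proof.
move=> a0 b0 a'0 b'0 zab zab'.
have ab'0 : 0 <= a * b' by rewrite mulr_ge0.
have a'b0 : 0 <= a' * b by rewrite mulr_ge0.
(* AM-GM for [a * b'] and [a' * b], in squared form so that no square roots of complex scalars
   appear. *)
have cross : `|z| * `|z'| *+ 2 <= a * b' + a' * b.
  rewrite -(@ler_pXn2r _ 2) ?nnegrE ?mulrn_wge0 ?mulr_ge0 ?addr_ge0 //.
  apply: (@le_trans _ _ (a * b * (a' * b') *+ 4)).
    have -> : (`|z| * `|z'| *+ 2) ^+ 2 = `|z| ^+ 2 * `|z'| ^+ 2 *+ 4.
      by rewrite -mulr_natr -[RHS]mulr_natr !exprMn -natrX.
    by rewrite lerMn2r ler_pM // exprn_ge0.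
  rewrite -subr_ge0.
  have -> : (a * b' + a' * b) ^+ 2 - a * b * (a' * b') *+ 4
      = (a * b' - a' * b) ^+ 2.
    by ring.
  by rewrite real_exprn_even_ge0 // realB // ger0_real.
apply: (@le_trans _ _ ((`|z| + `|z'|) ^+ 2)).
  by rewrite ler_pXn2r ?nnegrE ?addr_ge0 // ler_normD.
have -> : (a + a') * (b + b') = a * b + (a * b' + a' * b) + a' * b' by ring.
by rewrite sqrrD; apply: lerD => //; apply: lerD.
Qed.

Lemma le_sqr_norm_sum (C : numClosedFieldType) (I : finType) (z a b : I -> C) :
  (forall i, 0 <= a i) -> (forall i, 0 <= b i) ->
  (forall i, `|z i| ^+ 2 <= a i * b i) ->
  `|\sum_i z i| ^+ 2 <= (\sum_i a i) * \sum_i b i.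
Proof.
move=> a0 b0 zab.
(* The induction carries the signs of both partial sums, which the additive step needs. *)
suff [] : [/\ 0 <= \sum_i a i, 0 <= \sum_i b i &
    `|\sum_i z i| ^+ 2 <= (\sum_i a i) * \sum_i b i] by [].
apply: (big_ind3 (fun x y t => [/\ 0 <= y, 0 <= t & `|x| ^+ 2 <= y * t])).
- by rewrite normr0 expr0n mul0r.
- move=> x y t x' y' t' [y0 t0 xyt] [y'0 t'0 xyt'].
  by rewrite !addr_ge0 //; split=> //; exact: le_sqr_normD.
- by move=> i _; split.
Qed.

(** * Hermitian forms, diagonalization and square roots *)

Section Forms.
Variable R : realType.
Local Notation C := R[i].

Definition hform n (X : 'M[C]_n) (u v : 'cV[C]_n) : C :=
  (u^t* *m X *m v) 0 0.

Lemma adjmxM m n p (A : 'M[C]_(m, n)) (B : 'M[C]_(n, p)) :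
  (A *m B)^t* = B^t* *m A^t*.
Proof. by rewrite trmx_mul map_mxM. Qed.

Lemma hermsymmxE n (X : 'M[C]_n) : (X \is hermsymmx) = (X^t* == X).
Proof. by rewrite is_hermitianmxE expr0 scale1r eq_sym. Qed.

Lemma psdmx_adj n (X : 'M[C]_n) : psdmx X -> X^t* = X.
Proof. by case; rewrite hermsymmxE => /eqP. Qed.

Lemma hform_ge0 n (X : 'M[C]_n) u : psdmx X -> 0 <= hform X u u.
Proof. by case=> _; apply. Qed.

Lemma hform_mulmx m n (X : 'M[C]_m) (A : 'M[C]_(m, n)) u v :
  hform (A^t* *m X *m A) u v = hform X (A *m u) (A *m v).
Proof. by rewrite /hform adjmxM !mulmxA. Qed.

Lemma psdmx_mulmx m n (X : 'M[C]_m) (A : 'M[C]_(m, n)) :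
  psdmx X -> psdmx (A^t* *m X *m A).
Proof.
move=> Xp; split; last by move=> x; rewrite -/(hform _ x x) hform_mulmx hform_ge0.
by rewrite hermsymmxE !adjmxM trmxCK psdmx_adj // mulmxA.
Qed.

Lemma hform1E n (u : 'cV[C]_n) : hform 1%:M u u = \sum_i `|u i 0| ^+ 2.
Proof.
rewrite /hform mulmx1 mxE; apply: eq_bigr => i _.
by rewrite !mxE normCK mulrC.
Qed.

Lemma hform1_eq0 n (u : 'cV[C]_n) : (hform 1%:M u u == 0) = (u == 0).
Proof.
apply/eqP/eqP => [|->]; last by rewrite /hform mulmx0 mxE.
rewrite hform1E => /eqP; rewrite psumr_eq0 => [/allP u0|i _]; last first.
  by rewrite exprn_ge0.
apply/matrixP => i j; rewrite ord1 mxE; apply/eqP.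
by have := u0 i (mem_index_enum _); rewrite /= sqrf_eq0 normr_eq0.
Qed.

Lemma l2norm_hform n (u : 'cV[C]_n) : (l2norm u ^+ 2)%:C = hform 1%:M u u.
Proof.
rewrite /l2norm sqr_sqrtr ?sumr_ge0 // => [|i _]; last exact: sqr_ge0.
by rewrite hform1E rmorph_sum; apply: eq_bigr => i _; rewrite rmorphXn.
Qed.

Lemma l2norm_ge0 n (u : 'cV[C]_n) : 0 <= l2norm u.
Proof. exact: sqrtr_ge0. Qed.

Definition rdiag n (d : 'rV[R]_n) : 'M[C]_n := diag_mx (map_mx (real_complex R) d).

Lemma hform_rdiag n (d : 'rV[R]_n) u v :
  hform (rdiag d) u v = \sum_i (d 0 i)%:C * (Num.conj (u i 0) * v i 0).
Proof.
rewrite /hform -mulmxA mxE; apply: eq_bigr => i _.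
by rewrite mul_diag_mx !mxE mulrCA.
Qed.

Lemma psdmx_rdiag n (d : 'rV[R]_n) : (forall i, 0 <= d 0 i) -> psdmx (rdiag d).
Proof.
move=> d0; split=> [|x]; last first.
  rewrite -/(hform _ x x) hform_rdiag sumr_ge0 // => i _.
  by rewrite mulr_ge0 ?ler0c // mulrC mul_conjC_ge0.
rewrite hermsymmxE tr_diag_mx map_diag_mx; apply/eqP; congr diag_mx.
by apply/matrixP => i j; rewrite !mxE; exact: conjc_real.
Qed.

(** A Hermitian matrix has real eigenvalues, so taking real parts of [spectral_diag] loses
    nothing. *)
Lemma hermsymmx_spectral n (A : 'M[C]_n) : A \is hermsymmx ->
  exists (P : 'M[C]_n) (d : 'rV[R]_n),
    P \is unitarymx /\ A = P^t* *m rdiag d *m P.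
Proof.
move=> Ah; exists (spectralmx A), (map_mx (@complex.Re R) (spectral_diag A)).
have PU := spectral_unitarymx A; split; first exact: PU.
have /mxOverP dr := hermitian_spectral_diag_real Ah.
have /hermitian_normalmx/orthomx_spectralP := Ah.
rewrite (invmx_unitary PU); move: dr {PU}.
move: (spectral_diag A) (spectralmx A) => d P dr {1}->; rewrite /rdiag.
suff -> : map_mx (real_complex R) (map_mx (@complex.Re R) d) = d by [].
by apply/matrixP => i j; rewrite !mxE RRe_real.
Qed.

Lemma psdmx_spectral n (A : 'M[C]_n) : psdmx A ->
  exists (P : 'M[C]_n) (d : 'rV[R]_n), [/\ P \is unitarymx, forall i, 0 <= d 0 i,
    A = P^t* *m rdiag d *m P &
    forall f, mxfun f A = P^t* *m rdiag (map_mx f d) *m P].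
Proof.
case=> /hermsymmx_spectral[P [d [PU ->]]] A0; exists P, d; split=> [//|i||f].
(* The test vector is the eigenvector for [d 0 i], at which the form takes the value [d 0 i]. *)
- have := A0 (P^t* *m delta_mx i 0).
  rewrite -/(hform _ _ _) hform_mulmx mulmxA (unitarymxP PU) mul1mx.
  rewrite hform_rdiag (bigD1 i) //= big1 ?addr0 => [|j /negPf ji]; last first.
    by rewrite !mxE ji !mulr0.
  by rewrite !mxE !eqxx mulr1 conjC1 mulr1 ler0c.
- by [].
- rewrite -(invmx_unitary PU) (mxfun_diag f d PU).
  suff -> : map_mx (fun t => (f t)%:C) d = map_mx (real_complex R) (map_mx f d).
    by [].
  by apply/matrixP => i j; rewrite !mxE.
Qed.

(** In eigencoordinates the form is a sum of terms each of which satisfies the bound with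
    equality. *)
Lemma psdmx_CauchySchwarz n (X : 'M[C]_n) u v : psdmx X ->
  `|hform X u v| ^+ 2 <= hform X u u * hform X v v.
Proof.
move=> /psdmx_spectral[P [d [_ d0 -> _]]]; rewrite !hform_mulmx !hform_rdiag.
move: (P *m u) (P *m v) => {}u {}v.
have ge0 (w : 'cV[C]_n) i : 0 <= (d 0 i)%:C * (Num.conj (w i 0) * w i 0).
  by rewrite mulr_ge0 ?ler0c // mulrC mul_conjC_ge0.
apply: le_sqr_norm_sum => // i; rewrite !normrM norm_conjC !exprMn !normCK.
by rewrite (CrealP (ger0_real _)) ?ler0c //; rewrite le_eqVlt; apply/predU1P; left; ring.
Qed.

Lemma adj_mxsqrt n (X : 'M[C]_n) : psdmx X -> (mxsqrt X)^t* = mxsqrt X.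
Proof.
move=> /psdmx_spectral[P [d [_ _ _ fE]]]; apply: psdmx_adj; rewrite /mxsqrt fE.
by apply/psdmx_mulmx/psdmx_rdiag => i; rewrite mxE sqrtr_ge0.
Qed.

Lemma mulmx_unitary_conj n (P A B : 'M[C]_n) : P \is unitarymx ->
  (P^t* *m A *m P) *m (P^t* *m B *m P) = P^t* *m (A *m B) *m P.
Proof. by move=> PU; rewrite !mulmxA (mulmxtVK _ PU). Qed.

Lemma mxsqrtK n (X : 'M[C]_n) : psdmx X -> mxsqrt X *m mxsqrt X = X.
Proof.
move=> /psdmx_spectral[P [d [PU d0 XE fE]]].
rewrite /mxsqrt (fE (@Num.sqrt R)) (mulmx_unitary_conj _ _ PU) [RHS]XE.
suff -> : rdiag (map_mx Num.sqrt d) *m rdiag (map_mx Num.sqrt d) = rdiag d by [].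
apply/matrixP => i j; rewrite mul_diag_mx !mxE mulrnAr -rmorphM /= -expr2.
by rewrite sqr_sqrtr.
Qed.

(** * Euclidean norm, operator norm and eigenvalues *)

Lemma hform1_unitary n (P : 'M[C]_n) u : P \is unitarymx ->
  hform 1%:M (P *m u) (P *m u) = hform 1%:M u u.
Proof.
move=> PU; rewrite -hform_mulmx mulmx1 -(invmx_unitary PU).
by rewrite (mulVmx (unitarymx_unit PU)).
Qed.

Lemma l2norm_unitary n (P : 'M[C]_n) u : P \is unitarymx ->
  l2norm (P *m u) = l2norm u.
Proof.
move=> PU; apply/eqP; rewrite -(@eqrXn2 _ 2) ?l2norm_ge0 //.
by apply/eqP/complexI; rewrite !l2norm_hform hform1_unitary.
Qed.

Lemma l2norm_delta n (i : 'I_n) : l2norm (delta_mx i 0 : 'cV[C]_n) = 1.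
Proof.
apply/eqP; rewrite -(@eqrXn2 _ 2) ?l2norm_ge0 // expr1n; apply/eqP/complexI.
rewrite l2norm_hform hform1E (bigD1 i) //= big1 => [|j /negPf ji].
  by rewrite !mxE !eqxx normr1 expr1n addr0.
by rewrite mxE ji normr0 expr0n.
Qed.

Lemma l2normZ n (a : R) (u : 'cV[C]_n) : 0 <= a ->
  l2norm (a%:C *: u) = a * l2norm u.
Proof.
move=> a0; apply/eqP; rewrite -(@eqrXn2 _ 2) ?mulr_ge0 ?l2norm_ge0 // exprMn.
apply/eqP/complexI; rewrite [RHS]rmorphM /= !l2norm_hform !hform1E mulr_sumr.
apply: eq_bigr => i _; rewrite mxE normrM exprMn rmorphXn ger0_norm ?ler0c //.
Qed.

Lemma l2norm_rdiag n (d : 'rV[R]_n) (c : R) u :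
  (forall i, 0 <= d 0 i <= c) -> 0 <= c ->
  l2norm (rdiag d *m u) <= c * l2norm u.
Proof.
move=> dc c0; rewrite -(@ler_pXn2r _ 2) ?nnegrE ?mulr_ge0 ?l2norm_ge0 //.
rewrite exprMn -lecR [X in _ <= X]rmorphM /= !l2norm_hform !hform1E mulr_sumr ler_sum // => i _.
have /andP[d0 dic] := dc i.
rewrite mul_diag_mx !mxE normrM exprMn ler_wpM2r ?exprn_ge0 // rmorphXn /=.
by rewrite ler_pXn2r ?nnegrE // ?ler0c // ger0_norm ?ler0c // lecR.
Qed.

Lemma opnorm_le m n (A : 'M[C]_(m, n)) c :
  0 <= c -> (forall x, l2norm (A *m x) <= c * l2norm x) -> opnorm A <= c.
Proof.
move=> c0 Ac; apply: ge_sup => [|_ [x /= x1 <-]].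
  exists (l2norm (A *m 0)), 0 => //=.
  have -> : (0 : 'cV[C]_n) = 0%:C *: 0 by rewrite scaler0.
  by rewrite l2normZ // mul0r.
by apply: le_trans (Ac x) _; rewrite ler_piMr.
Qed.

(** The constant [c] only certifies that the set under [sup] is bounded; its value does not enter
    the conclusion. *)
Lemma l2norm_le_opnorm m n (A : 'M[C]_(m, n)) c :
  0 <= c -> (forall x, l2norm (A *m x) <= c * l2norm x) ->
  forall x, l2norm x <= 1 -> l2norm (A *m x) <= opnorm A.
Proof.
move=> c0 Ac x x1; apply: ub_le_sup; last by exists x.
by exists c => _ [y /= y1 <-]; apply: le_trans (Ac y) _; rewrite ler_piMr.
Qed.

Lemma opnorm_ge0 m n (A : 'M[C]_(m, n)) : 0 <= opnorm A.
Proof.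
rewrite /opnorm; set E := [set _ | _ in _]%classic.
(* Without a supremum, [sup] takes the default value 0. *)
have [[[r Er] ubE]|/sup_out->//] := pselect (has_sup E).
apply: le_trans (ub_le_sup ubE Er).
by case: Er => x _ <-; exact: l2norm_ge0.
Qed.

Lemma l2norm_spectral_le n (P : 'M[C]_n) (d : 'rV[R]_n) c :
  P \is unitarymx -> (forall i, 0 <= d 0 i <= c) -> 0 <= c ->
  forall x, l2norm (P^t* *m rdiag d *m P *m x) <= c * l2norm x.
Proof.
move=> PU dc c0 x; rewrite -!mulmxA l2norm_unitary ?trmxC_unitary //.
by rewrite -(l2norm_unitary x PU) l2norm_rdiag.
Qed.

Lemma spectral_eigenvector n (P : 'M[C]_n) (d : 'rV[R]_n) i :
  P \is unitarymx ->
  P^t* *m rdiag d *m P *m (P^t* *m (delta_mx i 0 : 'cV_n)) =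
  (d 0 i)%:C *: (P^t* *m (delta_mx i 0 : 'cV_n)).
Proof.
move=> PU; rewrite mulmxA mulmxtVK // -mulmxA scalemxAr; congr (_ *m _).
apply/matrixP => j k; rewrite mul_diag_mx !mxE.
by have [->//|] := eqVneq j i; rewrite !mulr0.
Qed.

Lemma spectral_le_opnorm n (P : 'M[C]_n) (d : 'rV[R]_n) i :
  P \is unitarymx -> (forall j, 0 <= d 0 j) ->
  d 0 i <= opnorm (P^t* *m rdiag d *m P).
Proof.
move=> PU d0; have e1 : l2norm (P^t* *m (delta_mx i 0 : 'cV[C]_n)) = 1.
  by rewrite l2norm_unitary ?trmxC_unitary // l2norm_delta.
have -> : d 0 i = l2norm (P^t* *m rdiag d *m P *m (P^t* *m (delta_mx i 0 : 'cV_n))).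
  by rewrite spectral_eigenvector // l2normZ // e1 mulr1.
(* The sum of the eigenvalues is a crude common upper bound for them. *)
apply: (@l2norm_le_opnorm _ _ _ (\sum_j d 0 j)); rewrite ?sumr_ge0 ?e1 //.
apply: l2norm_spectral_le; rewrite ?sumr_ge0 // => j; rewrite d0 (bigD1 j) //=.
by rewrite lerDl sumr_ge0.
Qed.

Lemma hform_le_opnorm n (Z : 'M[C]_n) u : psdmx Z ->
  hform Z u u <= (opnorm Z)%:C * hform 1%:M u u.
Proof.
move=> /psdmx_spectral[P [d [PU d0 -> _]]].
rewrite hform_mulmx hform_rdiag -(hform1_unitary u PU) hform1E mulr_sumr.
apply: ler_sum => i _; rewrite normCK [X in _ <= _ * X]mulrC ler_wpM2r //.
  by rewrite mulrC mul_conjC_ge0.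
by rewrite lecR spectral_le_opnorm.
Qed.

(** The norm of a positive semidefinite matrix is its largest eigenvalue; the eigenvalue 0 is
    covered by [0 <= c]. *)
Lemma opnorm_le_eigenvalue n (Z : 'M[C]_n) c : psdmx Z -> 0 <= c ->
  (forall (a : R) (w : 'cV[C]_n), 0 < a -> w != 0 -> Z *m w = a%:C *: w -> a <= c) ->
  opnorm Z <= c.
Proof.
move=> /psdmx_spectral[P [d [PU d0 -> _]]] c0 Zc; apply: opnorm_le => //.
apply: l2norm_spectral_le => // i; rewrite d0 /=.
have := d0 i; rewrite le_eqVlt => /predU1P[<-//|di0].
apply: Zc (spectral_eigenvector d i PU) => //.
rewrite -hform1_eq0 hform1_unitary ?trmxC_unitary // -l2norm_hform l2norm_delta.
by rewrite expr1n oner_eq0.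
Qed.

(** * The sandwich S Y S for a Hermitian square root S of X *)

Section SandwichedProduct.
Variables (n : nat) (X Y S : 'M[C]_n).
Hypotheses (Xp : psdmx X) (Yp : psdmx Y) (adjS : S^t* = S) (SS : S *m S = X).
Let Z := S *m Y *m S.

Lemma psdmx_sandwich : psdmx Z.
Proof. by rewrite /Z -{1}adjS; exact: psdmx_mulmx. Qed.

(** Since X Y X = S Z S and X = S S, this is the bound of [Z] by its norm, tested at [S *m u]. *)
Lemma hform_le_sandwichl u : hform (X *m Y *m X) u u <= (opnorm Z)%:C * hform X u u.
Proof.
have := hform_le_opnorm (S *m u) psdmx_sandwich.
rewrite -!hform_mulmx mulmx1 adjS SS.
by rewrite /Z !mulmxA SS -mulmxA SS.
Qed.

(** Cauchy-Schwarz for [Y] at [u] and X Y u, followed by the bound on X Y X at Y u, gives t^2 <= (u*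
    Y u) |Z| t; then [t] is cancelled. *)
Lemma hform_le_sandwichr u : hform (Y *m X *m Y) u u <= (opnorm Z)%:C * hform Y u u.
Proof.
set t := hform (Y *m X *m Y) u u.
have tE : t = hform X (Y *m u) (Y *m u) by rewrite -hform_mulmx psdmx_adj.
have t0 : 0 <= t by rewrite tE hform_ge0.
have := t0; rewrite le_eqVlt => /predU1P[<-|t1].
  by rewrite mulr_ge0 ?hform_ge0 // ler0c opnorm_ge0.
have : t ^+ 2 <= hform Y u u * ((opnorm Z)%:C * t).
  have := psdmx_CauchySchwarz u (X *m Y *m u) Yp.
  have -> : hform Y u (X *m Y *m u) = t by rewrite /t /hform !mulmxA.
  rewrite ger0_norm // => /le_trans; apply; rewrite ler_wpM2l ?hform_ge0 //.
  have -> : hform Y (X *m Y *m u) (X *m Y *m u) = hform (X *m Y *m X) (Y *m u) (Y *m u).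
    by have := hform_mulmx Y X (Y *m u) (Y *m u); rewrite (psdmx_adj Xp) !mulmxA.
  by rewrite tE hform_le_sandwichl.
by rewrite expr2 mulrA ler_pM2r // mulrC.
Qed.

(** S (Y S) and (Y S) S = Y X have the same nonzero eigenvalues: Y S maps eigenvectors of the first
    to eigenvectors of the second. *)
Lemma opnorm_sandwich_le c : 0 <= c ->
  (forall (a : R) (w : 'cV[C]_n), 0 < a -> w != 0 -> Y *m X *m w = a%:C *: w -> a <= c) ->
  opnorm Z <= c.
Proof.
move=> c0 YXc; apply: (opnorm_le_eigenvalue psdmx_sandwich c0) => a w a0 w0 Zw.
have ZwE : S *m (Y *m S *m w) = a%:C *: w by rewrite -Zw /Z !mulmxA.
apply: (YXc a (Y *m S *m w)) => //.
  (* The image is nonzero because [S] sends it to a nonzero multiple of [w]. *)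
  apply: contra_neq w0 => v0; move/esym/eqP: ZwE.
  by rewrite v0 mulmx0 scaler_eq0 (gt_eqF (_ : 0 < a%:C)) ?ltcR //= => /eqP.
by rewrite -{1}SS -!mulmxA scalemxAr scalemxAr -ZwE !mulmxA.
Qed.

End SandwichedProduct.

(** * The quadratic inequality between three sandwiches *)

Lemma opnorm_sandwich_sqr_le n (X X0 X1 Y Y0 Y1 S S0 S1 : 'M[C]_n) :
  S^t* = S -> S0^t* = S0 -> S1^t* = S1 ->
  S *m S = X -> S0 *m S0 = X0 -> S1 *m S1 = X1 ->
  psdmx X -> psdmx X0 -> psdmx X1 -> psdmx Y -> psdmx Y0 -> psdmx Y1 ->
  (forall u v, `|hform X u v| ^+ 2 <= hform X0 u u * hform X1 v v) ->
  (forall u v, `|hform Y u v| ^+ 2 <= hform Y0 u u * hform Y1 v v) ->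
  opnorm (S *m Y *m S) ^+ 2 <= opnorm (S0 *m Y0 *m S0) * opnorm (S1 *m Y1 *m S1).
Proof.
move=> SH S0H S1H SX S0X S1X Xp X0p X1p Yp Y0p Y1p XCS YCS.
have le_s := @opnorm_sandwich_le _ X Y S Yp SH SX.
have le0 := @hform_le_sandwichr _ X0 Y0 S0 X0p Y0p S0H S0X.
have le1 := @hform_le_sandwichl _ X1 Y1 S1 Y1p S1H S1X.
have s0_ge0 := opnorm_ge0 (S0 *m Y0 *m S0).
have s1_ge0 := opnorm_ge0 (S1 *m Y1 *m S1).
have s_ge0 := opnorm_ge0 (S *m Y *m S).
set s := opnorm (S *m Y *m S) in le_s s_ge0 *.
set s0 := opnorm (S0 *m Y0 *m S0) in le0 s0_ge0 *.
set s1 := opnorm (S1 *m Y1 *m S1) in le1 s1_ge0 *.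
clearbody s s0 s1.
have ss_ge0 : 0 <= s0 * s1 by rewrite mulr_ge0.
rewrite -[X in _ <= X]sqr_sqrtr // ler_pXn2r ?nnegrE ?sqrtr_ge0 //.
apply: le_s; rewrite ?sqrtr_ge0 // => a w a_gt0 w0 YXw.
rewrite -(@ler_pXn2r _ 2) ?nnegrE ?sqrtr_ge0 ?(ltW a_gt0) // sqr_sqrtr //.
pose h := X *m w; pose N := hform Y0 h h.
have Yh : Y *m h = a%:C *: w by rewrite /h mulmxA.
have aC_gt0 : 0 < a%:C :> C by rewrite ltcR.
(* [N] is cancelled at the end. If it vanished, Cauchy-Schwarz for [Y] at [h] and [w] would give a
   |w|^2 = 0. *)
have N_gt0 : 0 < N.
  rewrite lt_neqAle hform_ge0 // andbT eq_sym; apply: contra_neq w0 => N0.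
  have := YCS h w; rewrite -/N N0 mul0r.
  have -> : hform Y h w = a%:C * hform 1%:M w w.
    rewrite /hform -{1}(psdmx_adj Yp) -adjmxM Yh mulmx1 linearZ /= map_mxZ.
    by rewrite -scalemxAl mxE; congr (_ * _); exact: conjc_real.
  rewrite -normrX normr_le0 expf_eq0 /= mulf_eq0 (gt_eqF aC_gt0) /=.
  by rewrite hform1_eq0 => /eqP.
have le_a : hform X0 (Y0 *m h) (Y0 *m h) <= s0%:C * N.
  by rewrite -hform_mulmx (psdmx_adj Y0p) le0.
(* With t = b* X1 b = h* Y (X1 b), Cauchy-Schwarz for [Y] and the bound on X1 Y1 X1 give t^2 <= N s1
   t. *)
pose b := Y *m h; have le_b : hform X1 b b <= s1%:C * N.
  have := hform_ge0 b X1p; rewrite le_eqVlt => /predU1P[<-|t_gt0].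
    by rewrite mulr_ge0 ?ler0c ?(ltW N_gt0).
  rewrite -(ler_pM2r t_gt0) -expr2.
  have := YCS h (X1 *m b); rewrite -/N.
  have -> : hform Y h (X1 *m b) = hform X1 b b.
    by rewrite /hform -{1}(psdmx_adj Yp) -adjmxM !mulmxA.
  rewrite (ger0_norm (ltW t_gt0)) => /le_trans; apply.
  rewrite [_ * N]mulrC -mulrA (ler_wpM2l (ltW N_gt0)) //.
  by rewrite -hform_mulmx (psdmx_adj X1p) le1.
(* As b = a w and X w = h, the mixed form equals a N, so a^2 N^2 <= s0 s1 N^2. *)
have := XCS (Y0 *m h) b.
have -> : hform X (Y0 *m h) b = a%:C * N.
  rewrite /b Yh /N /hform adjmxM (psdmx_adj Y0p) -scalemxAr mxE; congr (_ * _).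
  by rewrite /h !mulmxA.
rewrite ger0_norm; last by rewrite mulr_ge0 ?(ltW aC_gt0) ?(ltW N_gt0).
move=> /le_trans /(_ (ler_pM (hform_ge0 _ X0p) (hform_ge0 _ X1p) le_a le_b)).
rewrite exprMn [X in _ <= X]mulrACA -[N * N]expr2 ler_pM2r ?exprn_gt0 //.
by rewrite -rmorphXn -rmorphM lecR.
Qed.

(** * Nonnegative combinations of fixed positive semidefinite matrices *)

Definition wsum (I : finType) n (p : I -> R) (X : I -> 'M[C]_n) : 'M[C]_n :=
  \sum_i (p i)%:C *: X i.

Section WeightedSums.
Variables (I : finType) (n : nat) (X : I -> 'M[C]_n).
Hypothesis Xp : forall i, psdmx (X i).

Lemma hform_wsum p u v :
  hform (wsum p X) u v = \sum_i (p i)%:C * hform (X i) u v.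
Proof.
rewrite /hform /wsum mulmx_sumr mulmx_suml summxE; apply: eq_bigr => i _.
by rewrite -scalemxAr -scalemxAl mxE.
Qed.

Lemma psdmx_wsum p : (forall i, 0 <= p i) -> psdmx (wsum p X).
Proof.
move=> p0; split=> [|x]; last first.
  rewrite -/(hform _ x x) hform_wsum sumr_ge0 // => i _.
  by rewrite mulr_ge0 ?ler0c ?hform_ge0.
rewrite hermsymmxE /wsum linear_sum raddf_sum; apply/eqP/eq_bigr => i _ /=.
by rewrite linearZ /= map_mxZ (psdmx_adj (Xp i)); congr (_ *: _); exact: conjc_real.
Qed.

Lemma wsum_CauchySchwarz p p0 p1 u v :
  (forall i, 0 <= p0 i) -> (forall i, 0 <= p1 i) ->
  (forall i, p i ^+ 2 <= p0 i * p1 i) ->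
  `|hform (wsum p X) u v| ^+ 2 <= hform (wsum p0 X) u u * hform (wsum p1 X) v v.
Proof.
move=> p0_ge0 p1_ge0 ple; rewrite !hform_wsum; apply: le_sqr_norm_sum => i.
- by rewrite mulr_ge0 ?ler0c ?hform_ge0.
- by rewrite mulr_ge0 ?ler0c ?hform_ge0.
rewrite normrM exprMn [X in _ <= X]mulrACA ler_pM ?exprn_ge0 //.
  by rewrite normCK (CrealP _) ?complex_real // -rmorphM -rmorphM lecR -expr2.
exact: psdmx_CauchySchwarz.
Qed.

End WeightedSums.

(** [X i] is the image of the i-th rank-one spectral projection of [A]. Linearity leaves [f] only in
    the weights, and positivity makes each [X i] positive semidefinite. *)
Lemma positive_map_mxfun n l (Phi : {linear 'M[C]_n -> 'M[C]_l}) (A : 'M[C]_n) :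
  positive_map Phi -> psdmx A ->
  exists (d : 'I_n -> R) (X : 'I_n -> 'M[C]_l), [/\ forall i, 0 <= d i,
    forall i, psdmx (X i) & forall f, Phi (mxfun f A) = wsum (f \o d) X].
Proof.
move=> Phip /psdmx_spectral[P [d [_ d0 _ fE]]].
exists (d 0), (fun i => Phi (P^t* *m rdiag (delta_mx 0 i) *m P)).
split=> // [i|f].
  apply/Phip/psdmx_mulmx/psdmx_rdiag => j; rewrite mxE.
  by case: (_ && _).
rewrite fE /wsum; under eq_bigr do rewrite -linearZ /=.
rewrite -linear_sum; congr (Phi _).
under eq_bigr do rewrite scalemxAl scalemxAr.
rewrite -mulmx_suml -mulmx_sumr; congr (_ *m _ *m _).
apply/matrixP => i j; rewrite summxE !mxE (bigD1 i) //= !mxE !eqxx /=.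
rewrite big1 => [|k /negPf ki]; first by rewrite mulrnAr mulr1 addr0.
by rewrite !mxE eq_sym ki mul0rn mulr0.
Qed.
End Forms.

(** * Real powers and geometric interpolation of two functions *)

(** Nonnegative exponents admit x = 0: their sum vanishes only if both do, in agreement with 0^0 =
    1. *)
Lemma powRD_ge0 (R : realType) (x a b : R) : 0 <= a -> 0 <= b ->
  powR x (a + b) = powR x a * powR x b.
Proof.
move=> a0 b0; have [->|x0] := eqVneq x 0; last by rewrite powRD // x0 implybT.
have [->|a_neq0] := eqVneq a 0; first by rewrite add0r powRr0 mul1r.
by rewrite (powR0 a_neq0) mul0r powR0 // paddr_eq0 // (negPf a_neq0).
Qed.

(** First enlarge the base to 1 + x >= 1, then the exponent to 1. The bound is uniform in [a]. *)
Lemma powR_le1D (R : realType) (x a : R) : 0 <= x -> 0 <= a <= 1 ->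
  powR x a <= 1 + x.
Proof.
move=> x0 /andP[a0 a1]; apply: (@le_trans _ _ (powR (1 + x) a)).
  by rewrite ge0_ler_powR ?nnegrE ?addr_ge0 // lerDr.
by rewrite ler1_powR // lerDl.
Qed.

Section GeomInterp.
Variables (R : realType) (f g : R -> R) (x : R).

Lemma geom_interp_ge0 a : 0 <= geom_interp a f g x.
Proof. by rewrite mulr_ge0 ?powR_ge0. Qed.

(** Each factor is exponential in the parameter, so midpoint log-convexity holds with equality, even
    where [f] or [g] vanishes. *)
Lemma geom_interp_mid (a b : R) : 0 <= a <= 1 -> 0 <= b <= 1 ->
  geom_interp ((a + b) / 2) f g x ^+ 2 =
  geom_interp a f g x * geom_interp b f g x.
Proof.
move=> /andP[a0 a1] /andP[b0 b1].
have sqr_mid (y u v : R) : 0 <= u -> 0 <= v ->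
    powR y ((u + v) / 2) ^+ 2 = powR y u * powR y v.
  move=> u0 v0; have uv0 : 0 <= (u + v) / 2 by rewrite divr_ge0 ?addr_ge0.
  by rewrite expr2 -!powRD_ge0 // -splitr.
rewrite /geom_interp exprMn (sqr_mid (g x) a b) //.
have -> : 1 - (a + b) / 2 = ((1 - a) + (1 - b)) / 2 by field.
by rewrite (sqr_mid (f x)) ?subr_ge0 // mulrACA.
Qed.

Lemma geom_interp0 : 0 <= f x -> geom_interp 0 f g x = f x.
Proof. by move=> f0; rewrite /geom_interp subr0 powRr1 // powRr0 mulr1. Qed.

Lemma geom_interp1 : 0 <= g x -> geom_interp 1 f g x = g x.
Proof. by move=> g0; rewrite /geom_interp subrr powRr1 // powRr0 mul1r. Qed.

Lemma geom_interp_le a : 0 <= f x -> 0 <= g x -> 0 <= a <= 1 ->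
  geom_interp a f g x <= (1 + f x) * (1 + g x).
Proof.
move=> f0 g0 /andP[a0 a1]; rewrite ler_pM ?powR_ge0 // powR_le1D //.
  by rewrite subr_ge0 a1 gerBl.
by rewrite a0.
Qed.

End GeomInterp.

(** * Bounded midpoint log-convex functions on [0, 1] *)

Section MidpointLogConvex.
Variable R : realType.
Implicit Types (f : R -> R) (K t : R).

Definition midpoint_log_convex f :=
  forall s t, 0 <= s <= 1 -> 0 <= t <= 1 -> f ((s + t) / 2) ^+ 2 <= f s * f t.

(* With S the supremum of f on [0, 1] and t the midpoint of 0 and 2t, or of
   2t - 1 and 1, we get f(t)^2 <= S for every t, hence S^2 <= S. *)
Lemma midpoint_log_convex_le1 f K :
  (forall t, 0 <= t <= 1 -> 0 <= f t <= K) -> midpoint_log_convex f ->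
  f 0 <= 1 -> f 1 <= 1 -> forall t, 0 <= t <= 1 -> f t <= 1.
Proof.
move=> fK fmid f0 f1.
pose E := [set f t | t in [set t | 0 <= t <= 1]]%classic.
have I0 : 0 <= (0 : R) <= 1 by rewrite lexx ler01.
have I1 : 0 <= (1 : R) <= 1 by rewrite lexx ler01.
have ubE : has_ubound E by exists K => _ [t /= /fK/andP[_ ?] <-].
have fS t : 0 <= t <= 1 -> f t <= sup E by move=> It; apply: ub_le_sup => //; exists t.
have f_ge0 t : 0 <= t <= 1 -> 0 <= f t by move=> /fK/andP[].
have sqS t : 0 <= t <= 1 -> f t ^+ 2 <= sup E.
  move=> It; have [t2|t2] := leP (2 * t) 1.
    have I2t : 0 <= 2 * t <= 1 by lra.
    have -> : t = (0 + 2 * t) / 2 by field.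
    apply: le_trans (fmid _ _ I0 I2t) _; apply: le_trans (fS _ I2t).
    by rewrite ler_piMl ?f_ge0.
  have I2t : 0 <= 2 * t - 1 <= 1 by lra.
  have -> : t = (2 * t - 1 + 1) / 2 by field.
  apply: le_trans (fmid _ _ I2t I1) _; apply: le_trans (fS _ I2t).
  by rewrite ler_piMr ?f_ge0.
have S0 : 0 <= sup E by apply: le_trans (fS _ I0); exact: f_ge0.
have S_le : sup E <= Num.sqrt (sup E).
  apply: ge_sup => [|_ [t /= It <-]]; first by exists (f 0), 0.
  by rewrite -[f t]ger0_norm ?f_ge0 // -sqrtr_sqr ler_wsqrtr ?sqS.
move=> t /fS/le_trans; apply; rewrite leNgt; apply/negP => S1.
have : sup E ^+ 2 <= sup E.
  by rewrite -[X in _ <= X]sqr_sqrtr // ler_pXn2r ?nnegrE ?sqrtr_ge0.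
by rewrite expr2 leNgt -[X in X < _]mulr1 ltr_pM2l ?S1 // (lt_trans ltr01).
Qed.

(** Multiplying by the geometric path from [e0] to [e1] keeps boundedness and midpoint
    log-convexity. Free weights, rather than inverses of endpoint values, also serve when an
    endpoint value is 0. *)
Lemma midpoint_log_convex_scale f K e0 e1 t :
  (forall t, 0 <= t <= 1 -> 0 <= f t <= K) -> midpoint_log_convex f ->
  0 <= e0 -> 0 <= e1 -> f 0 * e0 <= 1 -> f 1 * e1 <= 1 -> 0 <= t <= 1 ->
  f t * (powR e0 (1 - t) * powR e1 t) <= 1.
Proof.
move=> fK fmid e0_ge0 e1_ge0 f0 f1.
(* The functions are constant, so the evaluation point 0 is arbitrary. *)
pose m s := geom_interp s (fun=> e0) (fun=> e1) (0 : R).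
apply: (@midpoint_log_convex_le1 (fun s => f s * m s) (K * ((1 + e0) * (1 + e1)))).
- move=> s Is; have /andP[fs0 fsK] := fK _ Is.
  rewrite mulr_ge0 ?geom_interp_ge0 //= ler_pM ?geom_interp_ge0 //.
  exact: geom_interp_le.
- move=> r s Ir Is; rewrite exprMn /m geom_interp_mid // [X in _ <= X]mulrACA.
  by rewrite ler_wpM2r ?fmid // mulr_ge0 ?geom_interp_ge0.
- by rewrite /m geom_interp0.
- by rewrite /m geom_interp1.
Qed.

(** When [f 0] is 0 the weight [e0] is unconstrained, and a large one rules out [f t] > 0. *)
Lemma midpoint_log_convex_eq0 f K t :
  (forall t, 0 <= t <= 1 -> 0 <= f t <= K) -> midpoint_log_convex f ->
  f 0 = 0 -> 0 <= t < 1 -> f t = 0.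
Proof.
move=> fK fmid f0 /andP[t0 t1].
have It : 0 <= t <= 1 by rewrite t0 ltW.
have I1 : 0 <= (1 : R) <= 1 by rewrite lexx ler01.
have /andP[ft0 _] := fK _ It; have /andP[f1 _] := fK _ I1.
apply/eqP; apply: contraT => ft_neq0.
have ft_gt0 : 0 < f t by rewrite lt_neqAle eq_sym ft_neq0.
(* Adding 1 keeps [e1] positive and [f 1 * e1] at most 1 even if [f 1] is 0. *)
pose e1 := (1 + f 1)^-1; have e1_gt0 : 0 < e1 by rewrite invr_gt0 ltr_pwDl.
pose a := f t * powR e1 t; have a_gt0 : 0 < a by rewrite mulr_gt0 ?powR_gt0.
(* Chosen so that the scaled value at [t] is exactly 2; the exponent uses t < 1. *)
pose e0 := powR (2 / a) (1 - t)^-1.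
have := @midpoint_log_convex_scale f K e0 e1 t fK fmid (powR_ge0 _ _) (ltW e1_gt0).
rewrite f0 mul0r ler01 => /(_ isT).
rewrite ler_pdivrMr ?ltr_pwDl // mul1r lerDr ler01 => /(_ isT It).
rewrite mulrCA -/a /e0 -powRrM mulVf ?gt_eqF ?subr_gt0 // powRr1; last first.
  by rewrite divr_ge0 // ltW.
by rewrite divfK ?gt_eqF // leNgt ltr1n.
Qed.

Lemma midpoint_log_convexP f K t :
  (forall t, 0 <= t <= 1 -> 0 <= f t <= K) -> midpoint_log_convex f ->
  0 <= t <= 1 -> f t <= powR (f 0) (1 - t) * powR (f 1) t.
Proof.
move=> fK fmid It; have /andP[t0 t1] := It.
have I0 : 0 <= (0 : R) <= 1 by rewrite lexx ler01.
have I1 : 0 <= (1 : R) <= 1 by rewrite lexx ler01.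
have /andP[f0_ge0 _] := fK _ I0; have /andP[f1_ge0 _] := fK _ I1.
(* The endpoints come first: there a vanishing [f 0] or [f 1] may be raised to the power 0, giving
   1. *)
have [->|t_neq0] := eqVneq t 0; first by rewrite subr0 powRr1 // powRr0 mulr1.
have [->|t_neq1] := eqVneq t 1; first by rewrite subrr powRr1 // powRr0 mul1r.
have [f0|f0] := eqVneq (f 0) 0.
  rewrite (@midpoint_log_convex_eq0 f K t) ?mulr_ge0 ?powR_ge0 //.
  by rewrite t0 lt_neqAle t_neq1.
have [f1|f1] := eqVneq (f 1) 0.
  (* Reflecting the interval exchanges the two endpoints. *)
  have := @midpoint_log_convex_eq0 (fun s => f (1 - s)) K (1 - t).
  rewrite subr0 subKr => -> //; first by rewrite mulr_ge0 ?powR_ge0.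
  - by move=> s Is; apply: fK; lra.
  - move=> r s Ir Is; have -> : 1 - (r + s) / 2 = (1 - r + (1 - s)) / 2 by field.
    by apply: fmid; lra.
  - by rewrite subr_ge0 t1 gtrBl lt_neqAle eq_sym t_neq0.
(* These weights normalize both endpoint values to 1. *)
have := @midpoint_log_convex_scale f K (f 0)^-1 (f 1)^-1 t fK fmid.
rewrite !invr_ge0 !divff // => /(_ f0_ge0 f1_ge0 (lexx _) (lexx _) It).
have p0 : 0 < powR (f 0) (1 - t) by rewrite powR_gt0 // lt_neqAle eq_sym f0.
have p1 : 0 < powR (f 1) t by rewrite powR_gt0 // lt_neqAle eq_sym f1.
have powV x a : 0 <= x -> powR x^-1 a = (powR x a)^-1.
  by move=> x0; rewrite -(powR_inv1 x0) -powRrM mulN1r powRN.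
by rewrite !powV // -invfM ler_pdivrMr ?mulr_gt0 // mul1r.
Qed.

End MidpointLogConvex.

(** * Interpolation for weighted sums and for positive maps *)

Section WeightedSumInterpolation.
Variables (R : realType) (I J : finType) (l : nat).
Variables (X : I -> 'M[R[i]]_l) (Y : J -> 'M[R[i]]_l).
Hypotheses (Xp : forall i, psdmx (X i)) (Yp : forall j, psdmx (Y j)).

Let G (p : I -> R) (q : J -> R) : R :=
  opnorm (mxsqrt (wsum p X) *m wsum q Y *m mxsqrt (wsum p X)).

Lemma opnorm_wsum_sqr_le p p0 p1 q q0 q1 :
  (forall i, [/\ 0 <= p i, 0 <= p0 i, 0 <= p1 i & p i ^+ 2 <= p0 i * p1 i]) ->
  (forall j, [/\ 0 <= q j, 0 <= q0 j, 0 <= q1 j & q j ^+ 2 <= q0 j * q1 j]) ->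
  G p q ^+ 2 <= G p0 q0 * G p1 q1.
Proof.
move=> pP qP.
have Xpsd : psdmx (wsum p X) by apply: psdmx_wsum => // i; case: (pP i).
have X0psd : psdmx (wsum p0 X) by apply: psdmx_wsum => // i; case: (pP i).
have X1psd : psdmx (wsum p1 X) by apply: psdmx_wsum => // i; case: (pP i).
have Ypsd : psdmx (wsum q Y) by apply: psdmx_wsum => // j; case: (qP j).
have Y0psd : psdmx (wsum q0 Y) by apply: psdmx_wsum => // j; case: (qP j).
have Y1psd : psdmx (wsum q1 Y) by apply: psdmx_wsum => // j; case: (qP j).
have XCS u v : `|hform (wsum p X) u v| ^+ 2 <=
    hform (wsum p0 X) u u * hform (wsum p1 X) v v.
  by apply: wsum_CauchySchwarz => // i; case: (pP i).
have YCS u v : `|hform (wsum q Y) u v| ^+ 2 <=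
    hform (wsum q0 Y) u u * hform (wsum q1 Y) v v.
  by apply: wsum_CauchySchwarz => // j; case: (qP j).
exact (opnorm_sandwich_sqr_le
  (adj_mxsqrt Xpsd) (adj_mxsqrt X0psd) (adj_mxsqrt X1psd)
  (mxsqrtK Xpsd) (mxsqrtK X0psd) (mxsqrtK X1psd)
  Xpsd X0psd X1psd Ypsd Y0psd Y1psd XCS YCS).
Qed.

Lemma opnorm_wsum_geom_interp (f g : R -> R) (d : I -> R) (e : J -> R) a :
  (forall x, 0 <= x -> 0 <= f x) -> (forall x, 0 <= x -> 0 <= g x) ->
  (forall i, 0 <= d i) -> (forall j, 0 <= e j) -> 0 <= a <= 1 ->
  G (geom_interp a f g \o d) (geom_interp a f g \o e) <=
  powR (G (f \o d) (f \o e)) (1 - a) * powR (G (g \o d) (g \o e)) a.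
Proof.
move=> f_ge0 g_ge0 d_ge0 e_ge0 Ia.
(* [M] dominates every [h s] with s in [0, 1] on the nonnegative half-line. *)
pose h s := geom_interp s f g; pose M x := (1 + f x) * (1 + g x).
have h_mid s t : 0 <= s <= 1 -> 0 <= t <= 1 -> forall x,
    [/\ 0 <= h ((s + t) / 2) x, 0 <= h s x, 0 <= h t x &
        h ((s + t) / 2) x ^+ 2 <= h s x * h t x].
  by move=> Is It x; rewrite /h geom_interp_mid // !geom_interp_ge0.
have h_M s : 0 <= s <= 1 -> forall x, 0 <= x ->
    [/\ 0 <= h s x, 0 <= M x, 0 <= M x & h s x ^+ 2 <= M x * M x].
  move=> Is x x0; have M0 : 0 <= M x by rewrite mulr_ge0 ?addr_ge0 ?f_ge0 ?g_ge0.
  split=> //; first exact: geom_interp_ge0.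
  by rewrite -expr2 ler_pXn2r ?nnegrE ?geom_interp_ge0 // geom_interp_le ?f_ge0 ?g_ge0.
(* The endpoint identities need nonnegative values of [f] and [g], hence the composition with
   nonnegative points. *)
have h0 (T : Type) (c : T -> R) : (forall i, 0 <= c i) -> f \o c = h 0 \o c.
  by move=> c0; apply/funext => i; rewrite /h /= geom_interp0 ?f_ge0.
have h1 (T : Type) (c : T -> R) : (forall i, 0 <= c i) -> g \o c = h 1 \o c.
  by move=> c0; apply/funext => i; rewrite /h /= geom_interp1 ?g_ge0.
rewrite (h0 _ _ d_ge0) (h0 _ _ e_ge0) (h1 _ _ d_ge0) (h1 _ _ e_ge0).
pose F s := G (h s \o d) (h s \o e).
have sqrF_le s u v : (forall x, 0 <= x ->
      [/\ 0 <= h s x, 0 <= u x, 0 <= v x & h s x ^+ 2 <= u x * v x]) ->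
    F s ^+ 2 <= G (u \o d) (u \o e) * G (v \o d) (v \o e).
  move=> huv; exact (opnorm_wsum_sqr_le (p := h s \o d) (p0 := u \o d)
    (p1 := v \o d) (q := h s \o e) (q0 := u \o e) (q1 := v \o e)
    (fun i => huv _ (d_ge0 i)) (fun j => huv _ (e_ge0 j))).
have FM s : 0 <= s <= 1 -> 0 <= F s <= G (M \o d) (M \o e).
  move=> Is; apply/andP; split; first exact: opnorm_ge0.
  (* With both outer functions equal to [M], the quadratic inequality reads F(s)^2 <= G(M, M)^2. *)
  have := sqrF_le s M M (h_M s Is).
  by rewrite -expr2 ler_pXn2r ?nnegrE //; exact: opnorm_ge0.
have Fmid : midpoint_log_convex F.
  by move=> s t Is It; exact (sqrF_le _ _ _ (fun x _ => h_mid s t Is It x)).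
exact (midpoint_log_convexP FM Fmid Ia).
Qed.

End WeightedSumInterpolation.

Theorem proposition2p2 (R : realType) (n m l : nat)
    (Phi : {linear 'M[R[i]]_n -> 'M[R[i]]_l})
    (Psi : {linear 'M[R[i]]_m -> 'M[R[i]]_l})
    (phi0 phi1 : R -> R) (alpha : R)
    (A : 'M[R[i]]_n) (B : 'M[R[i]]_m) :
  positive_map Phi -> positive_map Psi ->
  (forall x : R, 0 <= x -> 0 <= phi0 x) ->
  (forall x : R, 0 <= x -> 0 <= phi1 x) ->
  0 <= alpha <= 1 ->
  psdmx A -> psdmx B ->
  let phia := geom_interp alpha phi0 phi1 in
  opnorm (mxsqrt (Phi (mxfun phia A)) *m Psi (mxfun phia B)
            *m mxsqrt (Phi (mxfun phia A)))
  <= powR (opnorm (mxsqrt (Phi (mxfun phi0 A)) *m Psi (mxfun phi0 B)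
                     *m mxsqrt (Phi (mxfun phi0 A)))) (1 - alpha)
     * powR (opnorm (mxsqrt (Phi (mxfun phi1 A)) *m Psi (mxfun phi1 B)
                       *m mxsqrt (Phi (mxfun phi1 A)))) alpha.
Proof.
move=> Phip Psip phi0_ge0 phi1_ge0 Ialpha Ap Bp; cbv zeta.
(* The points and matrices obtained do not depend on the function, so all three functions share
   them. *)
have [d [X [d0 Xp XE]]] := positive_map_mxfun Phip Ap.
have [e [Y [e0 Yp YE]]] := positive_map_mxfun Psip Bp.
have := opnorm_wsum_geom_interp Xp Yp phi0_ge0 phi1_ge0 d0 e0 Ialpha.
rewrite -(XE (geom_interp alpha phi0 phi1)) -(YE (geom_interp alpha phi0 phi1)).
by rewrite -(XE phi0) -(YE phi0) -(XE phi1) -(YE phi1).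
Qed.
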